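(* Let $\Gamma$ be a subgroup of $\mathbb{C}\times\mathbb{Z}_2$ with $1\in\Gamma_0$, and let $M=M_{\overline 0}\oplus M_{\overline 1}$ be an $s\mathcal{V}_\Gamma$-module. If $M$, regarded as a $\mathbb{C}[L_0]$-module, is free of rank $(1\mid 1)$ (that is, $M_{\overline 0}$ and $M_{\overline 1}$ are each free $\mathbb{C}[L_0]$-modules of rank $1$), then $C$ acts on $M$ by zero and, for some $f\in\Gamma^\vee$ and $\alpha\in\mathbb{C}$, $$M\cong s\Omega_\Gamma(f,\alpha)\quad\text{or}\quad M\cong\Pi(s\Omega_\Gamma(f,\alpha)).$$
   Context: The base field is $\mathbb{C}$. $\Gamma^\vee$ is the set of group homomorphisms $\Gamma\to\mathbb{C}^*$. For a subgroup $\Gamma\subset\mathbb{C}\times\mathbb{Z}_2$, put $\Gamma_0=\{x\in\mathbb{C}\mid(x,0)\in\Gamma\}$, $\Gamma_1=\{x\in\mathbb{C}\mid(x,1)\in\Gamma\}$; for $f\in\Gamma^\vee$, $m\in\Gamma_0$, $r\in\Gamma_1$ write $f(m)=f((m,0))$, $f(r)=f((r,1))$. $s\mathcal{V}_\Gamma$ is the Lie superalgebra whose even part has basis $\{L_m\}_{m\in\Gamma_0}\cup\{C\}$ and whose odd part has basis $\{G_r\}_{r\in\Gamma_1}$, with $C$ central, $[L_m,L_n]=(m-n)L_{m+n}+\delta_{m+n,0}\frac{m^3-m}{12}C$, $[L_m,G_r]=(\tfrac m2-r)G_{m+r}$, $[G_r,G_s]=2L_{r+s}+\frac{C}{3}(r^2-\tfrac14)\delta_{r+s,0}$.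 Modules are $\mathbb{Z}_2$-graded and isomorphisms preserve parity. $s\Omega_\Gamma(f,\alpha)$ is the space $\mathbb{C}[L_0]\oplus\xi\mathbb{C}[L_0]$ (first summand even, second odd) with $$L_m(P(L_0)+\xi Q(L_0))=f(m)(L_0+m\alpha)P(L_0+m)+f(m)(L_0+m(\alpha+\tfrac12))\,\xi Q(L_0+m),$$ $$G_r(P(L_0)+\xi Q(L_0))=f(r)(L_0+2r\alpha)Q(L_0+r)+f(r)\,\xi P(L_0+r),$$ and $C$ acting by zero; here polynomial coefficients in front of $\xi$ are understood as elements of $\xi\mathbb{C}[L_0]$ via $p(L_0)\xi q(L_0)=\xi p(L_0)q(L_0)$. $\Pi$ is the parity switching functor, $\Pi(V)_{\overline i}=V_{\overline{i+1}}$.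
   Formalization: The formal theorem also assumes that Γ_1 is nonempty; if Γ_1 is empty the claim fails, e.g. when M_0 and M_1 are both the rank-one module L_m P = L_0 P(L_0+m), since the parameters of the two halves of sΩ_Γ(f,α) differ by 1/2. *)

(* Defs.v *)
From HB Require Import structures.
From mathcomp Require Import all_boot all_order all_algebra.
From mathcomp Require Import finmap sesquilinear monalg complex reals ring.
Set Implicit Arguments.
Unset Strict Implicit.
Unset Printing Implicit Defensive.
Import GRing.Theory Num.Theory.
Local Open Scope ring_scope.

Record superspace (K : fieldType) := Superspace {
  carrier :> lmodType K;
  part : 'Z_2 -> submodClosed carrier;
  part_sum : forall v : carrier,
    exists v0 v1, [/\ v0 \in part 0, v1 \in part 1 & v = v0 + v1];
  part_cap : forall v : carrier, v \in part 0 -> v \in part 1 -> v = 0 }.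

Definition koszul (K : fieldType) (i j : 'Z_2) : K :=
  (-1) ^+ (nat_of_ord i * nat_of_ord j)%N.

Record lieSuperalgebra (K : fieldType) := LieSuperalgebra {
  lie_space :> superspace K;
  lie_br : {bilinear lie_space -> lie_space -> lie_space};
  lie_br_part : forall i j x y,
    x \in part lie_space i -> y \in part lie_space j ->
    lie_br x y \in part lie_space (i + j);
  lie_br_skew : forall i j x y,
    x \in part lie_space i -> y \in part lie_space j ->
    lie_br x y = - (koszul K i j *: lie_br y x);
  lie_br_jacobi : forall i j k x y z,
    x \in part lie_space i -> y \in part lie_space j ->
    z \in part lie_space k ->
    lie_br x (lie_br y z) =
      lie_br (lie_br x y) z + koszul K i j *: lie_br y (lie_br x z) }.

Record smodule (K : fieldType) (g : lieSuperalgebra K) := Smodule {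
  mod_space :> superspace K;
  act : {bilinear g -> mod_space -> mod_space};
  act_part : forall i j x v,
    x \in part g i -> v \in part mod_space j ->
    act x v \in part mod_space (i + j);
  act_br : forall i j x y v,
    x \in part g i -> y \in part g j ->
    act (lie_br g x y) v =
      act x (act y v) - koszul K i j *: act y (act x v) }.

Definition smodule_iso (K : fieldType) (g : lieSuperalgebra K)
    (M N : smodule g) : Prop :=
  exists phi : {linear M -> N},
    [/\ bijective phi,
        forall i v, v \in part M i -> phi v \in part N i &
        forall x v, phi (act M x v) = act N x (phi v)].

Section Parity.
Variables (K : fieldType).

Lemma Z2_cases (i : 'Z_2) : i = 0 \/ i = 1.
Proof. by case: i => [[|[|n]] hi] //; [left|right]; apply: val_inj. Qed.

Lemma Z2_11 : 1 + 1 = 0 :> 'Z_2.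
Proof. exact: val_inj. Qed.

Section Pi_space.
Variable V : superspace K.

Definition Pi_part (i : 'Z_2) : submodClosed V := part V (i + 1).

Lemma Pi_part_sum (v : V) :
  exists v0 v1, [/\ v0 \in Pi_part 0, v1 \in Pi_part 1 & v = v0 + v1].
Proof.
have [v0 [v1 [h0 h1 ->]]] := part_sum v.
by exists v1, v0; rewrite /Pi_part add0r Z2_11 addrC.
Qed.

Lemma Pi_part_cap (v : V) : v \in Pi_part 0 -> v \in Pi_part 1 -> v = 0.
Proof. by rewrite /Pi_part add0r Z2_11 => h1 h0; apply: part_cap. Qed.

Definition Pi_space := Superspace Pi_part_sum Pi_part_cap.
End Pi_space.

Section Pi_module.
Variables (g : lieSuperalgebra K) (M : smodule g).

Lemma Pi_act_part i j x (v : Pi_space M) :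
  x \in part g i -> v \in part (Pi_space M) j ->
  act M x v \in part (Pi_space M) (i + j).
Proof. by move=> hx hv; rewrite /= /Pi_part -addrA; apply: act_part. Qed.

(* The parity switch leaves the action unchanged (no sign is inserted). *)
Definition Pi_module : smodule g :=
  @Smodule K g (Pi_space M) (act M) Pi_act_part (@act_br _ _ M).
End Pi_module.
End Parity.

Definition poly_act (K : fieldType) (V : lmodType K) (T : V -> V)
    (p : {poly K}) (v : V) : V :=
  \sum_(i < size p) p`_i *: iter i T v.

(* U is seen as a K[X]-module, X acting by T; T must preserve U. *)
Definition free_of_rank (K : fieldType) (V : lmodType K) (T : V -> V)
    (U : {pred V}) (n : nat) : Prop :=
  exists e : 'I_n -> V,
    (forall i, e i \in U) /\
    (forall v, v \in U -> exists! c : {ffun 'I_n -> {poly K}},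
       v = \sum_(i < n) poly_act T (c i) (e i)).

Record subgroup_of (V : zmodType) (S : zmodClosed V) :=
  SubgroupElt { subgroup_val : V; subgroup_valP : subgroup_val \in S }.

HB.instance Definition _ (V : zmodType) (S : zmodClosed V) :=
  [isSub for @subgroup_val V S].
HB.instance Definition _ (V : zmodType) (S : zmodClosed V) :=
  [Choice of subgroup_of S by <:].
HB.instance Definition _ (V : zmodType) (S : zmodClosed V) :=
  [SubChoice_isSubZmodule of subgroup_of S by <:].

Record character (K : fieldType) (V : zmodType) (S : zmodClosed V) :=
  Character {
    chi :> subgroup_of S -> K;
    chi_neq0 : forall x, chi x != 0;
    chiD : forall x y, chi (x + y) = chi x * chi y }.

(* {malg K[T]} is the space of finitely supported functions T -> K, with basis
   bvec K k, and lext h is the linear map sending bvec K k to h k. Both are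
   locked because unification otherwise unfolds them down to finmaps. *)
HB.lock Definition lext (K : fieldType) (T : choiceType) (V : lmodType K)
  (h : T -> V) (a : {malg K[T]}) : V := \sum_(k <- msupp a) a@_k *: h k.

HB.lock Definition bvec (K : fieldType) (T : choiceType) (k : T) :
  {malg K[T]} := << k >>.

Section LinearExtension.
Variables (K : fieldType) (T : choiceType) (V : lmodType K).
Implicit Types (h : T -> V) (a b : {malg K[T]}).

Lemma lextEw h a (d : {fset T}) :
  (msupp a `<=` d)%fset -> lext h a = \sum_(k <- d) a@_k *: h k.
Proof.
move=> sd; rewrite lext.unlock (big_fset_incl _ sd) // => k _ /mcoeff_outdom ->.
by rewrite scale0r.
Qed.

Lemma lext_is_linear h : linear (lext h).
Proof.
move=> c a b; pose d := (msupp a `|` msupp b `|` msupp (c *: a + b))%fset.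
have sab : (msupp (c *: a + b) `<=` d)%fset by apply: fsubsetUr.
have sa : (msupp a `<=` d)%fset by rewrite /d -fsetUA fsubsetUl.
have sb : (msupp b `<=` d)%fset by rewrite /d fsetUAC fsubsetUr.
rewrite (lextEw _ sab) (lextEw _ sa) (lextEw _ sb).
rewrite scaler_sumr -big_split; apply: eq_bigr => k _ /=.
by rewrite mcoeffD mcoeffZ scalerDl scalerA.
Qed.
HB.instance Definition _ h :=
  GRing.isLinear.Build K {malg K[T]} V *:%R (lext h) (lext_is_linear h).

Lemma lextU h k : lext h (bvec K k) = h k.
Proof.
rewrite bvec.unlock (@lextEw _ _ [fset k]%fset) ?msuppU_le //.
by rewrite big_seq_fset1 mcoeffUU scale1r.
Qed.

Lemma comb_aux (c d : K) (u v u' v' : V) :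
  c *: (u + d *: v) + (u' + d *: v') = c *: u + u' + d *: (c *: v + v').
Proof. by rewrite !scalerDr !scalerA (mulrC d) addrACA. Qed.

Lemma bvecE a : a = \sum_(k <- msupp a) a@_k *: bvec K k.
Proof.
rewrite {1}[a]monalgE; apply: eq_bigr => k _; rewrite bvec.unlock.
by apply/malgP => l; rewrite mcoeffZ !mcoeffU mulr_natr.
Qed.

Lemma eq_lext h h' a : h =1 h' -> lext h a = lext h' a.
Proof. by move=> e; rewrite lext.unlock; apply: eq_bigr => k _; rewrite e. Qed.

Lemma lext_comb c h h' a :
  lext (fun k => c *: h k + h' k) a = c *: lext h a + lext h' a.
Proof.
rewrite lext.unlock scaler_sumr -big_split; apply: eq_bigr => k _ /=.
by rewrite scalerDr !scalerA mulrC.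
Qed.
End LinearExtension.

Section SuperVirasoro.
Variables (K : numFieldType) (Gamma : zmodClosed (K * 'Z_2)%type).
Local Notation GT := (subgroup_of Gamma).

(* Basis: Some (m, 0) is L_m, Some (r, 1) is G_r, and None is C. *)
Definition sV := {malg K[option GT]}.

Definition val0 (x : GT) : K := (\val x).1.
Definition par (x : GT) : 'Z_2 := (\val x).2.
Definition bpar (k : option GT) : 'Z_2 := if k is Some x then par x else 0.

(* [e_x, e_y] = sV_coef x y e_{x+y} + sV_cocycle x y C; the cases
   are LL, LG, GL = - LG, GG. *)
Definition sV_coef (x y : GT) : K :=
  let m := val0 x in let n := val0 y in
  if par x == 0 then (if par y == 0 then m - n else m / 2%:R - n)
  else (if par y == 0 then - (n / 2%:R - m) else 2%:R).

Definition sV_cocycle (x y : GT) : K :=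
  let m := val0 x in
  if x + y != 0 then 0
  else if par x == 0 then (m ^+ 3 - m) / 12%:R
  else (m ^+ 2 - 1 / 4%:R) / 3%:R.

Definition sV_basis_br (k l : option GT) : sV :=
  if k is Some x then
    if l is Some y then
      sV_coef x y *: bvec K (Some (x + y))
        + sV_cocycle x y *: bvec K None
    else 0
  else 0.

Definition sV_br (a b : sV) : sV := lext (fun k => lext (sV_basis_br k) b) a.

Lemma sV_br_bilinear : bilinear_for *:%R *:%R sV_br.
Proof.
split=> [b|a] c u v; first exact: linearP.
rewrite /sV_br -lext_comb; apply: eq_lext => k; exact: linearP.
Qed.
HB.instance Definition _ :=
  bilinear_isBilinear.Build K sV sV sV *:%R *:%R sV_br sV_br_bilinear.

Lemma brPl c a b d : sV_br (c *: a + b) d = c *: sV_br a d + sV_br b d.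
Proof. exact: sV_br_bilinear.1. Qed.
Lemma brPr c a b d : sV_br d (c *: a + b) = c *: sV_br d a + sV_br d b.
Proof. exact: sV_br_bilinear.2. Qed.
Lemma br0l a : sV_br 0 a = 0. Proof. exact: linear0l. Qed.
Lemma br0r a : sV_br a 0 = 0. Proof. exact: linear0r. Qed.
Lemma brZl c a d : sV_br (c *: a) d = c *: sV_br a d.
Proof. by rewrite -[c *: a]addr0 brPl br0l addr0. Qed.
Lemma brZr c a d : sV_br d (c *: a) = c *: sV_br d a.
Proof. by rewrite -[c *: a]addr0 brPr br0r addr0. Qed.

Lemma sV_brU k l : sV_br (bvec K k) (bvec K l) = sV_basis_br k l.
Proof. by rewrite /sV_br !lextU. Qed.

Definition sV_part (i : 'Z_2) : {pred sV} :=
  [pred a | all (fun k => bpar k == i) (msupp a)].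

Lemma sV_partP i a :
  reflect (forall k, bpar k != i -> a@_k = 0) (a \in sV_part i).
Proof.
apply: (iffP allP) => [h k /negP hk|h k hk].
  by apply/eqP; rewrite mcoeff_eq0; apply/negP => /h.
by apply/negPn/negP => /h /eqP; rewrite mcoeff_eq0 hk.
Qed.

Lemma sV_part_submod i : GRing.subsemimod_closed (sV_part i).
Proof.
split=> [|c a /sV_partP ha].
  split=> [|a b /sV_partP ha /sV_partP hb]; apply/sV_partP => k hk.
    by rewrite mcoeff0.
  by rewrite mcoeffD ha // hb // addr0.
by apply/sV_partP => k hk; rewrite mcoeffZ ha // mulr0.
Qed.
HB.instance Definition _ i :=
  GRing.isSubmodClosed.Build K sV (sV_part i) (sV_part_submod i).

Lemma sV_partU i k : bpar k = i -> bvec K k \in sV_part i.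
Proof.
move=> hk; apply/sV_partP => l hl; rewrite bvec.unlock mcoeffU.
by case: (k =P l) => // kl; rewrite -kl hk eqxx in hl.
Qed.

Lemma sV_ind (i : 'Z_2) (P : sV -> Prop) :
  P 0 -> (forall c a b, P a -> P b -> P (c *: a + b)) ->
  (forall k, bpar k = i -> P (bvec K k)) -> forall a, a \in sV_part i -> P a.
Proof.
move=> P0 PD PU a /allP ha; rewrite (bvecE a).
rewrite big_seq; elim/big_rec: _ => // k b /ha /eqP hk hb.
by apply: PD => //; apply: PU.
Qed.

Lemma sV_part_sum (a : sV) :
  exists v0 v1, [/\ v0 \in sV_part 0, v1 \in sV_part 1 & a = v0 + v1].
Proof.
exists (\sum_(k <- msupp a | bpar k == 0) a@_k *: bvec K k).
exists (\sum_(k <- msupp a | bpar k != 0) a@_k *: bvec K k).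
split; last by rewrite {1}(bvecE a) (bigID (fun k => bpar k == 0)).
  by apply: rpred_sum => k /eqP hk; apply: rpredZ; apply: sV_partU.
apply: rpred_sum => k hk; apply: rpredZ; apply: sV_partU.
by have [h|//] := Z2_cases (bpar k); rewrite h eqxx in hk.
Qed.

Lemma sV_part_cap (a : sV) : a \in sV_part 0 -> a \in sV_part 1 -> a = 0.
Proof.
move=> /sV_partP h0 /sV_partP h1; apply/malgP => k; rewrite mcoeff0.
by have [h|h] := Z2_cases (bpar k); [apply: h1|apply: h0]; rewrite h.
Qed.

Definition sV_space : superspace K :=
  @Superspace K sV (fun i => sV_part i : submodClosed sV)
    sV_part_sum sV_part_cap.

Lemma val0D x y : val0 (x + y) = val0 x + val0 y. Proof. by []. Qed.
Lemma parD x y : par (x + y) = par x + par y. Proof. by []. Qed.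
Lemma par0 : par 0 = 0. Proof. by []. Qed.
Lemma val0N x : val0 (- x) = - val0 x. Proof. by []. Qed.
Lemma parN x : par (- x) = par x.
Proof.
have -> : par (- x) = - par x by [].
by have [->|->] := Z2_cases (par x); apply: val_inj.
Qed.

Lemma sV_br_part i j (a b : sV) :
  a \in sV_part i -> b \in sV_part j -> sV_br a b \in sV_part (i + j).
Proof.
move=> ha hb; move: a ha; apply: sV_ind => [|c a a' h h'|k hk].
- by rewrite br0l rpred0.
- by rewrite brPl rpredD // rpredZ.
move: b hb; apply: sV_ind => [|c a a' h h'|l hl].
- by rewrite br0r rpred0.
- by rewrite brPr rpredD // rpredZ.
rewrite sV_brU; case: k l hk hl => [x|] [y|] hk hl; rewrite /= ?rpred0 //.
rewrite rpredD //; first by rewrite rpredZ // sV_partU // -hk -hl.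
rewrite /sV_cocycle; case: eqP => [xy|_] /=; last by rewrite scale0r rpred0.
by rewrite rpredZ // sV_partU // -hk -hl /= -parD xy.
Qed.

Definition parE :=
  (add0r, addr0, Z2_11, eqxx, oner_eq0 'Z_2).

Lemma sV_coef_skew x y :
  sV_coef x y = - (koszul K (par x) (par y) * sV_coef y x).
Proof.
rewrite /sV_coef /koszul.
by have [->|->] := Z2_cases (par x); have [->|->] := Z2_cases (par y);
  rewrite ?parE /=; ring.
Qed.

Lemma sV_cocycle_skew x y :
  sV_cocycle x y = - (koszul K (par x) (par y) * sV_cocycle y x).
Proof.
rewrite /sV_cocycle (addrC y x); case: (x + y =P 0) => [xy|_] /=; last first.
  by rewrite mulr0 oppr0.
have -> : y = - x by apply/eqP; rewrite -addr_eq0 addrC xy.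
rewrite parN val0N /koszul.
by have [->|->] := Z2_cases (par x); rewrite ?parE /=; ring.
Qed.

Lemma sV_br_skew i j (a b : sV) :
  a \in sV_part i -> b \in sV_part j ->
  sV_br a b = - (koszul K i j *: sV_br b a).
Proof.
move=> ha hb; move: a ha; apply: sV_ind => [|c a a' h h'|k hk].
- by rewrite br0l br0r scaler0 oppr0.
- rewrite brPl brPr /= h h' scalerDr opprD scalerN !scalerA.
  by rewrite mulrC.
move: b hb; apply: sV_ind => [|c a a' h h'|l hl].
- by rewrite br0l br0r scaler0 oppr0.
- rewrite brPl brPr /= h h' scalerDr opprD scalerN !scalerA.
  by rewrite mulrC.
rewrite !sV_brU; case: k l hk hl => [x|] [y|] hk hl /=;
  try by rewrite scaler0 oppr0.
rewrite -hk -hl scalerDr opprD !scalerA (addrC y x) -!scaleNr.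
by rewrite -sV_coef_skew -sV_cocycle_skew.
Qed.

Lemma sV_coef_jacobi x y z :
  sV_coef y z * sV_coef x (y + z) =
    sV_coef x y * sV_coef (x + y) z
    + koszul K (par x) (par y) * (sV_coef x z * sV_coef y (x + z)).
Proof.
rewrite /sV_coef /koszul !parD !val0D.
by have [->|->] := Z2_cases (par x); have [->|->] := Z2_cases (par y);
  have [->|->] := Z2_cases (par z); rewrite ?parE /=; field.
Qed.

Lemma sV_cocycle_jacobi x y z :
  sV_coef y z * sV_cocycle x (y + z) =
    sV_coef x y * sV_cocycle (x + y) z
    + koszul K (par x) (par y) * (sV_coef x z * sV_cocycle y (x + z)).
Proof.
rewrite /sV_cocycle (addrCA y x z) addrA.
case: (x + y + z =P 0) => [xyz|_] /=; last by rewrite !mulr0 addr0.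
have -> : z = - (x + y) by apply/eqP; rewrite -addr_eq0 addrC xyz.
rewrite /sV_coef /koszul !parN !val0N !parD !val0D.
by have [->|->] := Z2_cases (par x); have [->|->] := Z2_cases (par y);
  rewrite ?parE /=; field.
Qed.

Lemma brbr x y z :
  sV_br (bvec K (Some x)) (sV_br (bvec K (Some y)) (bvec K (Some z))) =
  (sV_coef y z * sV_coef x (y + z)) *: bvec K (Some (x + (y + z)))
  + (sV_coef y z * sV_cocycle x (y + z)) *: bvec K None.
Proof.
rewrite (sV_brU (Some y)) /= brPr brZr !sV_brU /= scaler0 addr0.
by rewrite scalerDr !scalerA.
Qed.

Lemma brbrl x y z :
  sV_br (sV_br (bvec K (Some x)) (bvec K (Some y))) (bvec K (Some z)) =
  (sV_coef x y * sV_coef (x + y) z) *: bvec K (Some (x + y + z))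
  + (sV_coef x y * sV_cocycle (x + y) z) *: bvec K None.
Proof.
rewrite (sV_brU (Some x)) /= brPl brZl !sV_brU /= scaler0 addr0.
by rewrite scalerDr !scalerA.
Qed.

Lemma sV_br_jacobi i j k (a b c : sV) :
  a \in sV_part i -> b \in sV_part j -> c \in sV_part k ->
  sV_br a (sV_br b c) =
    sV_br (sV_br a b) c + koszul K i j *: sV_br b (sV_br a c).
Proof.
move=> ha hb hc; move: a ha; apply: sV_ind => [|t a a' h h'|u hu].
- by rewrite !(br0l, br0r) scaler0 addr0.
- rewrite !(brPl, brPr). rewrite h h'. exact: comb_aux.
move: b hb; apply: sV_ind => [|t a a' h h'|v hv].
- by rewrite !(br0l, br0r) scaler0 addr0.
- rewrite !(brPl, brPr). rewrite h h'. exact: comb_aux.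
move: c hc; apply: sV_ind => [|t a a' h h'|w hw].
- by rewrite !(br0l, br0r) scaler0 addr0.
- rewrite !(brPl, brPr). rewrite h h'. exact: comb_aux.
have brNl l : sV_br (bvec K None) (bvec K l) = 0 by rewrite sV_brU.
have brNr l : sV_br (bvec K l) (bvec K None) = 0 by rewrite sV_brU; case: l.
have brNx : sV_br (bvec K None) (sV_br (bvec K v) (bvec K w)) = 0.
  rewrite sV_brU; case: v w {hv hw} => [y|] [z|] /=; try exact: br0r.
  by rewrite brPr brZr !brNl !scaler0 addr0.
have sc0 l : l *: (0 : sV) = 0 by rewrite scaler0.
rewrite -hu -hv.
case: u hu => [x|] hu; last first.
  by rewrite brNx (brNl v) br0l (brNl w) br0r sc0 addr0.
case: v hv brNx => [y|] hv brNx; last first.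
  rewrite (brNl w) (brNr (Some x)) br0l br0r add0r.
  case: w hw {brNx} => [z|] hw; last by rewrite brNr br0r sc0.
  by rewrite sV_brU /= brPr brZr !brNl !sc0 addr0 sc0.
case: w hw brNx => [z|] hw brNx; last first.
  rewrite (brNr (Some x)) (brNr (Some y)) !br0r sc0 addr0.
  by rewrite sV_brU /= brPl brZl !brNr !sc0 addr0.
rewrite !brbr brbrl (addrCA y x z) addrA scalerDr !scalerA.
by rewrite [RHS]addrACA -!scalerDl -sV_coef_jacobi -sV_cocycle_jacobi.
Qed.

Definition super_virasoro : lieSuperalgebra K :=
  @LieSuperalgebra K sV_space sV_br sV_br_part sV_br_skew sV_br_jacobi.

Definition sV_L (m : K) (hm : (m, 0) \in Gamma) : super_virasoro :=
  bvec K (Some (SubgroupElt hm)).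
Definition sV_G (r : K) (hr : (r, 1) \in Gamma) : super_virasoro :=
  bvec K (Some (SubgroupElt hr)).
Definition sV_C : super_virasoro := bvec K None.
Definition sV_L0 : super_virasoro := sV_L (rpred0 Gamma).

Lemma sV_LL m n (hm : (m, 0) \in Gamma) (hn : (n, 0) \in Gamma)
    (hmn : (m + n, 0) \in Gamma) :
  lie_br super_virasoro (sV_L hm) (sV_L hn) =
    (m - n) *: sV_L hmn
    + (if m + n == 0 then (m ^+ 3 - m) / 12%:R else 0) *: sV_C.
Proof.
rewrite /= sV_brU /= /sV_coef /sV_cocycle /par /val0 /= if_neg.
have -> : SubgroupElt hm + SubgroupElt hn = SubgroupElt hmn :> GT.
  by apply: val_inj; congr pair; apply: val_inj.
by rewrite -(inj_eq val_inj) /= xpair_eqE eqxx andbT.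
Qed.

Lemma sV_LG m r (hm : (m, 0) \in Gamma) (hr : (r, 1) \in Gamma)
    (hmr : (m + r, 1) \in Gamma) :
  lie_br super_virasoro (sV_L hm) (sV_G hr) = (m / 2%:R - r) *: sV_G hmr.
Proof.
rewrite /= sV_brU /= /sV_coef /sV_cocycle /par /val0 /=.
have -> : SubgroupElt hm + SubgroupElt hr = SubgroupElt hmr :> GT.
  by apply: val_inj; congr pair; apply: val_inj.
have -> : (SubgroupElt hmr == 0 :> GT) = false.
  by apply/negP => /eqP /(congr1 par).
by rewrite scale0r addr0.
Qed.

Lemma sV_GG r s (hr : (r, 1) \in Gamma) (hs : (s, 1) \in Gamma)
    (hrs : (r + s, 0) \in Gamma) :
  lie_br super_virasoro (sV_G hr) (sV_G hs) =
    2%:R *: sV_L hrs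
    + (if r + s == 0 then (r ^+ 2 - 1 / 4%:R) / 3%:R else 0) *: sV_C.
Proof.
rewrite /= sV_brU /= /sV_coef /sV_cocycle /par /val0 /= if_neg.
have e : SubgroupElt hr + SubgroupElt hs = SubgroupElt hrs :> GT.
  by apply: val_inj; congr pair; apply: val_inj.
by rewrite e -(inj_eq val_inj) /= xpair_eqE eqxx andbT.
Qed.

Section Omega.
Variables (f : character K Gamma) (alpha : K).
Local Notation PP := ({poly K} * {poly K})%type.

Definition shift (m : K) (p : {poly K}) : {poly K} := p \Po ('X + m%:P).

(* The pair (P, Q) stands for P(L_0) + xi Q(L_0), with 'X as L_0. *)
Definition Omega_basis (k : option GT) (v : PP) : PP :=
  if k is Some x then
    let m := val0 x in
    if par x == 0 then
      (f x *: (('X + (m * alpha)%:P) * shift m v.1),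
       f x *: (('X + (m * (alpha + 1 / 2%:R))%:P) * shift m v.2))
    else
      (f x *: (('X + (2%:R * m * alpha)%:P) * shift m v.2),
       f x *: shift m v.1)
  else 0.

Definition Omega_act (a : sV) (v : PP) : PP :=
  lext (fun k => Omega_basis k v) a.

Lemma Omega_basis_linear k : linear (Omega_basis k).
Proof.
move=> c [p q] [p' q']; case: k => [x|] /=; last by rewrite scaler0 addr0.
by case: ifP => _; congr pair;
  rewrite /= /shift !(comp_polyD, comp_polyZ) -!mul_polyC; ring.
Qed.

Lemma Omega_act_bilinear : bilinear_for *:%R *:%R Omega_act.
Proof.
split=> [v|a] c u w; first exact: linearP.
by rewrite /Omega_act -lext_comb; apply: eq_lext => k; apply: Omega_basis_linear.
Qed.
HB.instance Definition _ :=
  bilinear_isBilinear.Build K sV PP PP *:%R *:%R Omega_act Omega_act_bilinear.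

Lemma oactPl c a b v : Omega_act (c *: a + b) v = c *: Omega_act a v + Omega_act b v.
Proof. exact: Omega_act_bilinear.1. Qed.
Lemma oactPr c a v w : Omega_act a (c *: v + w) = c *: Omega_act a v + Omega_act a w.
Proof. exact: Omega_act_bilinear.2. Qed.
Lemma oact0l v : Omega_act 0 v = 0. Proof. exact: linear0l. Qed.
Lemma oact0r a : Omega_act a 0 = 0. Proof. exact: linear0r. Qed.
Lemma oactU k v : Omega_act (bvec K k) v = Omega_basis k v.
Proof. by rewrite /Omega_act lextU. Qed.

Definition Omega_part (i : 'Z_2) : {pred PP} :=
  [pred v : PP | if i == 0 then v.2 == 0 else v.1 == 0].

Lemma Omega_part_submod i : GRing.subsemimod_closed (Omega_part i).
Proof.
split=> [|c v]; last first.
  by rewrite !inE; case: ifP => _ /eqP /= ->; rewrite scaler0.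
split=> [|v w]; rewrite !inE; case: ifP => _ //=.
  by move=> /eqP -> /eqP ->; rewrite addr0.
by move=> /eqP -> /eqP ->; rewrite addr0.
Qed.
HB.instance Definition _ i :=
  GRing.isSubmodClosed.Build K PP (Omega_part i) (Omega_part_submod i).

Lemma Omega_part_sum (v : PP) :
  exists v0 v1, [/\ v0 \in Omega_part 0, v1 \in Omega_part 1 & v = v0 + v1].
Proof.
exists (v.1, 0), (0, v.2); split; rewrite ?inE //=.
by case: v => p q; congr pair; rewrite /= ?addr0 ?add0r.
Qed.

Lemma Omega_part_cap (v : PP) :
  v \in Omega_part 0 -> v \in Omega_part 1 -> v = 0.
Proof. by case: v => p q; rewrite !inE /= => /eqP -> /eqP ->. Qed.

Definition Omega_space : superspace K :=
  @Superspace K PP (fun i => Omega_part i : submodClosed PP)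
    Omega_part_sum Omega_part_cap.

Lemma Omega_act_part i j (a : sV) (v : PP) :
  a \in sV_part i -> v \in Omega_part j -> Omega_act a v \in Omega_part (i + j).
Proof.
move=> ha hv; move: a ha; apply: sV_ind => [|c a b h h'|k hk].
- by rewrite oact0l rpred0.
- by rewrite oactPl rpredD // rpredZ.
rewrite oactU -hk; case: k {hk} => [x|] /=; last by rewrite rpred0.
move: hv; rewrite !inE.
have [->|->] := Z2_cases (par x); have [->|->] := Z2_cases j;
  by rewrite ?parE /= => /eqP ->; rewrite /shift comp_poly0 ?mulr0 scaler0.
Qed.

Lemma shiftD m n p : shift m (shift n p) = shift (m + n) p.
Proof.
rewrite /shift -comp_polyA; congr (_ \Po _).
by rewrite comp_polyD comp_polyX comp_polyC polyCD addrA.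
Qed.

Lemma shift_lin m n c p :
  shift m (c *: (('X + n%:P) * p)) = c *: (('X + (m + n)%:P) * shift m p).
Proof.
by rewrite /shift comp_polyZ comp_polyM comp_polyD comp_polyX comp_polyC polyCD addrA.
Qed.

Lemma shiftZ m c p : shift m (c *: p) = c *: shift m p.
Proof. exact: comp_polyZ. Qed.

Lemma Omega_basis_br x y v :
  sV_coef x y *: Omega_basis (Some (x + y)) v =
  Omega_basis (Some x) (Omega_basis (Some y) v)
  - koszul K (par x) (par y) *: Omega_basis (Some y) (Omega_basis (Some x) v).
Proof.
case: v => p q; rewrite /Omega_basis /sV_coef /koszul parD val0D chiD.
have e z : val0 z = 2%:R * (val0 z / 2%:R) by field.
have e1 (t : K) : 2%:R * t / 2%:R = t by field.
have e2 (t : K) : 2%:R * t * (alpha + 1 / 2%:R) = 2%:R * t * alpha + t by field.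
rewrite (e x) (e y) -!mulrDr !e1 !e2.
move: (val0 x / _) (val0 y / _) (f x) (f y) => m n a b.
have [->|->] := Z2_cases (par x); have [->|->] := Z2_cases (par y);
  rewrite ?parE /=; congr pair;
  rewrite /= ?(shift_lin, shiftZ, shiftD) -?(mulrDr 2%:R) ?(addrC n m);
  rewrite -!mul_polyC; ring.
Qed.
Lemma Omega_act_br i j (a b : sV) (v : PP) :
  a \in sV_part i -> b \in sV_part j ->
  Omega_act (sV_br a b) v =
    Omega_act a (Omega_act b v) - koszul K i j *: Omega_act b (Omega_act a v).
Proof.
move=> ha hb; move: a ha; apply: sV_ind => [|c a a' h h'|k hk].
- by rewrite br0l !oact0l oact0r scaler0 subr0.
- rewrite brPl !oactPl oactPr h h' -!scaleNr; exact: comb_aux.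
move: b hb; apply: sV_ind => [|c a a' h h'|l hl].
- by rewrite br0r !oact0l oact0r scaler0 subr0.
- rewrite brPr !oactPl oactPr h h' -!scaleNr; exact: comb_aux.
have bN w : Omega_basis None w = 0 by [].
have b0 u : Omega_basis u 0 = 0 by rewrite -oactU oact0r.
rewrite sV_brU !oactU -hk -hl.
case: k {hk} => [x|]; last first.
  by rewrite [sV_basis_br _ _]/= oact0l !bN b0 scaler0 subr0.
case: l {hl} => [y|]; last first.
  by rewrite [sV_basis_br _ _]/= oact0l !bN b0 scaler0 subr0.
rewrite [sV_basis_br _ _]/= oactPl oactU.
rewrite -[_ *: bvec K None]addr0 oactPl oact0l addr0 oactU bN scaler0 addr0.
exact: Omega_basis_br.
Qed.

Definition super_Omega : smodule super_virasoro :=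
  @Smodule K super_virasoro Omega_space Omega_act Omega_act_part Omega_act_br.

Lemma super_Omega_L m (hm : (m, 0) \in Gamma) (p q : {poly K}) :
  act super_Omega (sV_L hm) (p, q) =
    (f (SubgroupElt hm) *: (('X + (m * alpha)%:P) * (p \Po ('X + m%:P))),
     f (SubgroupElt hm) *:
       (('X + (m * (alpha + 1 / 2%:R))%:P) * (q \Po ('X + m%:P)))).
Proof. by rewrite /= oactU. Qed.

Lemma super_Omega_G r (hr : (r, 1) \in Gamma) (p q : {poly K}) :
  act super_Omega (sV_G hr) (p, q) =
    (f (SubgroupElt hr) *:
       (('X + (2%:R * r * alpha)%:P) * (q \Po ('X + r%:P))),
     f (SubgroupElt hr) *: (p \Po ('X + r%:P))).
Proof. by rewrite /= oactU. Qed.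

Lemma super_Omega_C v : act super_Omega sV_C v = 0.
Proof. by rewrite /= oactU. Qed.

End Omega.
End SuperVirasoro.

(* Main.v *)
From HB Require Import structures.
Require Import Defs.
From mathcomp Require Import all_boot all_order all_algebra.
From mathcomp Require Import complex reals.
From mathcomp Require Import ring sesquilinear.
Set Implicit Arguments.
Unset Strict Implicit.
Unset Printing Implicit Defensive.
Import GRing.Theory Num.Theory.
Local Open Scope ring_scope.

(** Choose generators of the two halves of [M]. A basis vector of weight [m]
    commutes with [L_0] up to the translation by [m], so its action is recorded
    by one polynomial per half, the image of the generator, and the module
    axioms become identities between polynomials and their shifts
    ([coef_bracket]).

    Each half is a rank one module over the Virasoro algebra spanned by the even
    elements, and these are classified by degree considerations
    ([rank_one_virasoro]): [L_m L_-m] minus [L_-m L_m] has degree one, and one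
    product is a shift of the other, so the coefficients [a_m] and [a_-m] have
    total degree two; the case where one of them is constant is excluded by a
    difference equation. Hence [a_m = f(m) (X + t_m)]. Comparing coefficients in
    the brackets makes [f] a character and [t_m = m alpha], and the cocycle at
    weight 2 then forces [C] to act by zero.

    For odd [s], [G_s] squares to [L_2s], whose polynomial has degree one, so
    exactly one of the two coefficients of [G_s] is constant
    ([size_odd_coef]). Exchanging the halves with the parity switch, the
    constant may be taken on the even generator for some [r]. The brackets with
    the [L_m] then identify the characters of the two halves, show that their
    parameters differ by 1/2, and give [G_(m+r) = f(m) G_r] on the even
    generator ([lead_even_coef_eq], [exponent_shift], [odd_coef_translate]);
    the coefficients on the odd generator follow from the squares.

    What remains is to extend [f] to odd elements, where a square root of
    [f(2r)] has to be chosen, and to rescale the odd generator accordingly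
    ([iso_super_Omega_of_const]). *)

(** * Shifts of polynomials *)

Section Shift.
Variable K : numFieldType.
Implicit Types (p q : {poly K}) (m n : K).

Lemma coef_XaddC_exp m (n k : nat) :
  (('X + m%:P) ^+ n)`_k = m ^+ (n - k) *+ 'C(n, k).
Proof.
have [kn|nk] := leqP k n; last first.
  rewrite bin_small // mulr0n nth_default //.
  by rewrite -[m%:P]opprK -polyCN size_exp_XsubC.
rewrite addrC exprDn coef_sum (bigD1 (Ordinal (kn : k < n.+1)%N)) //=.
rewrite big1 => [|i /negPf ik].
  by rewrite coefMn -rmorphXn coefCM coefXn eqxx mulr1 addr0.
rewrite coefMn -rmorphXn coefCM coefXn; have -> : (k == i) = false.
  by rewrite eq_sym -ik.
by rewrite mulr0 mul0rn.
Qed.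

Lemma coef_shift m p k :
  (shift m p)`_k = \sum_(i < size p) p`_i * (m ^+ (i - k) *+ 'C(i, k)).
Proof.
by rewrite /shift coef_comp_poly; apply: eq_bigr => i _; rewrite coef_XaddC_exp.
Qed.

Lemma size_shift m p : size (shift m p) = size p.
Proof. by rewrite /shift size_comp_poly2 // size_XaddC. Qed.

Lemma shiftM m p q : shift m (p * q) = shift m p * shift m q.
Proof. exact: comp_polyM. Qed.

Lemma shiftC m c : shift m c%:P = c%:P.
Proof. exact: comp_polyC. Qed.

Lemma shift0 p : shift 0 p = p.
Proof. by rewrite /shift addr0 comp_polyXr. Qed.

Lemma horner_shift m p z : (shift m p).[z] = p.[z + m].
Proof. by rewrite /shift horner_comp !hornerE. Qed.

(** In characteristic zero the difference operator lowers the degree by exactly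
    one: below the leading terms, which cancel, the coefficient of degree [d - 1]
    of the difference is [d * m] times the leading coefficient. Every degree
    estimate below goes through this. *)
Lemma size_shift_sub m p : m != 0 -> size (shift m p - p) = (size p).-1.
Proof.
move=> m0; have [p1|] := leqP (size p) 1.
  by rewrite (size1_polyC p1) shiftC subrr size_poly0 size_polyC; case: eqP.
case sp: (size p) => [|[|d]] // _ /=.
have top k : (d <= k)%N ->
    (shift m p - p)`_k = if k == d then p`_d.+1 * m *+ d.+1 else 0.
  move=> dk; rewrite coefB coef_shift sp 2!big_ord_recr /= big1 => [|i _]; last first.
    by rewrite bin_small ?mulr0n ?mulr0 // (leq_trans (ltn_ord i)).
  have [->|kd] := eqVneq k d.
    by rewrite binn subnn subSnn binSn expr1 expr0 mulr1n mulr1 add0r addrC addrK mulrnAr.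
  have dk' : (d < k)%N by rewrite ltn_neqAle eq_sym kd.
  rewrite (bin_small dk') mulr0n mulr0 !add0r.
  have [->|kd1] := eqVneq k d.+1.
    by rewrite binn subnn expr0 mulr1 subrr.
  have dk2 : (d.+1 < k)%N by rewrite ltn_neqAle eq_sym kd1.
  by rewrite bin_small // mulr0n mulr0 nth_default ?sp // subrr.
apply/eqP; rewrite eqn_leq; apply/andP; split.
  apply/leq_sizeP => k dk; rewrite top ?(ltnW dk) //.
  by rewrite gtn_eqF.
rewrite ltnNge; apply/negP => /leq_sizeP /(_ d (leqnn d)) /eqP.
rewrite top // eqxx mulrn_eq0 /= mulf_eq0 (negPf m0) orbF.
suff -> : p`_d.+1 = lead_coef p by rewrite lead_coef_eq0 -size_poly_eq0 sp.
by rewrite lead_coefE sp.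
Qed.

Lemma shift_fixed_const m p : m != 0 -> shift m p = p -> p = (p`_0)%:P.
Proof.
move=> m0 e; apply: size1_polyC; rewrite -subn_eq0 subn1.
by rewrite -(size_shift_sub p m0) e subrr size_poly0.
Qed.

Lemma size2_poly p : size p = 2%N ->
  p = lead_coef p *: ('X + (p`_0 / lead_coef p)%:P).
Proof.
move=> sp; have l0 : lead_coef p != 0 by rewrite lead_coef_eq0 -size_poly_eq0 sp.
rewrite scalerDr -mul_polyC -[X in _ + X]mul_polyC -polyCM mulrC mulrCA divff // mulr1.
apply/polyP => k; rewrite coefD coefMC coefX coefC lead_coefE sp.
case: k => [|[|k]] /=; rewrite ?(mul0r, mul1r, add0r, addr0) //.
by rewrite nth_default // sp.
Qed.
End Shift.

(** * Rank one modules over the Virasoro subalgebra *)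

(** Lets [ring] check that one equation is a multiple of another. *)
Lemma eq_of_subr_eq (V : zmodType) (a b c d : V) :
  a = b -> c - d = a - b -> c = d.
Proof. by move=> -> /eqP; rewrite subrr subr_eq0 => /eqP. Qed.

(** On a rank one module, [L_x] sends the generator to [a x] times itself and,
    since [L_x L_0 = (L_0 + nu x) L_x], acts on its other multiples through
    [shift (nu x)]. The hypotheses say that [a] and the polynomial [c] of the
    central element satisfy the brackets of the even part; [G] is the index
    group and [one] the index of weight 1. *)
Section RankOneVirasoro.
Variables (K : numFieldType) (G : zmodType) (nu : {additive G -> K}) (one : G).
Variables (a : G -> {poly K}) (c : {poly K}).
Hypothesis nu_inj : injective nu.
Hypothesis nu_one : nu one = 1.
Hypothesis a_zero : a 0 = 'X.
Hypothesis a_bracket : forall x y,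
  shift (nu x) (a y) * a x - shift (nu y) (a x) * a y =
  (nu x - nu y) *: a (x + y)
  + (if x + y == 0 then (nu x ^+ 3 - nu x) / 12%:R else 0) *: c.
Hypothesis a_central : forall x, a x * c = shift (nu x) c * a x.

Lemma nu_eq0 x : (nu x == 0) = (x == 0).
Proof. by rewrite -(raddf0 nu) (inj_eq nu_inj). Qed.

Lemma a_opp x :
  shift (nu x) (a (- x)) * a x - shift (- nu x) (a x) * a (- x) =
  (2%:R * nu x) *: 'X + ((nu x ^+ 3 - nu x) / 12%:R) *: c.
Proof.
by rewrite -raddfN a_bracket subrr eqxx a_zero raddfN opprK -mulr2n mulr_natl.
Qed.

(** The central term vanishes at weight 1, so the bracket of [L_1] and [L_-1]
    is [2 L_0], which acts injectively. *)
Lemma a_one_neq0 : a one != 0.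
Proof.
apply/eqP => e; have := a_opp one.
rewrite e /shift comp_poly0 mulr0 mul0r subrr nu_one expr1n subrr mul0r scale0r addr0.
by move/esym/eqP; rewrite mulr1 scaler_eq0 polyX_eq0 pnatr_eq0.
Qed.

(** [C] commutes with [L_1], so its polynomial is fixed by a unit shift. *)
Lemma c_const : c = (c`_0)%:P.
Proof.
apply: (@shift_fixed_const _ 1); first exact: oner_neq0.
apply: (mulIf a_one_neq0); rewrite [RHS]mulrC a_central nu_one //.
Qed.

Lemma a_opp_const x :
  shift (nu x) (a (- x)) * a x - shift (- nu x) (a x) * a (- x) =
  (2%:R * nu x) *: 'X + ((nu x ^+ 3 - nu x) / 12%:R * c`_0)%:P.
Proof. by rewrite a_opp {1}c_const polyCM mul_polyC. Qed.

Lemma size_affine (m t : K) : m != 0 -> size (m *: 'X + t%:P) = 2%N.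
Proof.
by move=> m0; rewrite -mul_polyC size_MXaddC polyC_eq0 (negPf m0) /= size_polyC m0.
Qed.

(** Let [F] be the polynomial of [L_x L_-x]. That of [L_-x L_x] is a shift of
    [F], so [F] minus its shift has degree one and [F] has degree two. *)
Lemma size_a_opp x : x != 0 -> (size (a x) + size (a (- x)) = 4)%N.
Proof.
rewrite -nu_eq0 => m0.
pose F := shift (nu x) (a (- x)) * a x.
have eF : shift (- nu x) F = shift (- nu x) (a x) * a (- x).
  by rewrite shiftM shiftD addNr shift0 mulrC.
have := size_shift_sub F (m := - nu x); rewrite oppr_eq0 => /(_ m0).
rewrite eF -opprB size_polyN a_opp_const size_affine; last first.
  by rewrite mulf_neq0 // pnatr_eq0.
move=> sF; have {sF} sF : size F = 3%N by case: (size F) sF => //= n <-.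
have : F != 0 by rewrite -size_poly_eq0 sF.
rewrite mulf_eq0 negb_or => /andP [F1 F2].
move: sF; rewrite size_mul // size_shift => sF.
have := size_poly_gt0 (a x); rewrite F2; case: (size (a x)) sF => // n.
by rewrite addnS /= addnC addSn => -> .
Qed.

Lemma a_neq0 x : a x != 0.
Proof.
have [->|x0] := eqVneq x 0; first by rewrite a_zero polyX_eq0.
apply/eqP => e; have := a_opp_const x.
rewrite e /shift comp_poly0 mulr0 mul0r subrr => /(congr1 (@size _ \o val)) /=.
rewrite size_affine ?size_poly0 // mulf_neq0 // ?pnatr_eq0 //.
by rewrite nu_eq0.
Qed.

(** If [a x] had degree two, [a (- x)] would be constant, and bracketing
    [L_(-x)] with [L_2x] would express [a x] as a multiple of a
    difference of [a (x + x)].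
    The latter would have degree three, against [size_a_opp]. *)
Lemma size_a_neq3 x : x != 0 -> size (a x) != 3%N.
Proof.
move=> x0; apply/eqP => s3.
have m0 : nu x != 0 by rewrite nu_eq0.
have s1 : size (a (- x)) = 1%N.
  by have := size_a_opp x0; rewrite s3 => -[].
have xx0 : x + x != 0.
  by rewrite -nu_eq0 raddfD -mulr2n mulrn_eq0 (negPf m0).
have := a_bracket (- x) (x + x).
have -> : - x + (x + x) = x by rewrite addKr.
rewrite (negPf x0) scale0r addr0 raddfN raddfD.
have [k k0 ->] : exists2 k, k != 0 & a (- x) = k%:P.
  have e := size1_polyC (eq_leq s1); exists (a (- x))`_0 => //.
  by apply/eqP => e0; move: s1; rewrite e e0 size_poly0.
rewrite shiftC [_ * k%:P]mulrC -mulrBr mul_polyC => /(congr1 (@size _ \o val)) /=.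
rewrite !size_scale ?size_shift_sub ?oppr_eq0 //; last first.
  by rewrite -opprD oppr_eq0 -mulr2n -mulrS mulrn_eq0.
rewrite s3 => e4; have := size_a_opp xx0.
have := size_poly_gt0 (a (- (x + x))); rewrite a_neq0.
by case: (size (a (x + x))) e4 => //= n ->; case: (size _).
Qed.

Lemma size_a x : size (a x) = 2%N.
Proof.
have [->|x0] := eqVneq x 0; first by rewrite a_zero size_polyX.
have := size_a_opp x0; have := size_a_neq3 x0.
have := @size_a_neq3 (- x); rewrite oppr_eq0 => /(_ x0).
have := a_neq0 x; have := a_neq0 (- x); rewrite -!size_poly_gt0.
case: (size (a x)) => [|[|[|[|n]]]] //; case: (size (a (- x))) => [|[|[|[|k]]]] //.
all: by rewrite !(addSn, addnS).
Qed.

Definition lc x := lead_coef (a x).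
(** Minus the root of [a x], once [a x] is known to have degree one. *)
Definition root0 x := (a x)`_0 / lc x.

Lemma lc_neq0 x : lc x != 0. Proof. by rewrite lead_coef_eq0 a_neq0. Qed.

Lemma a_eval x z : (a x).[z] = lc x * (z + root0 x).
Proof. by rewrite [in LHS](size2_poly (size_a x)) !hornerE. Qed.

Lemma a_bracket_eval x y z :
  lc y * (z + nu x + root0 y) * (lc x * (z + root0 x))
  - lc x * (z + nu y + root0 x) * (lc y * (z + root0 y)) =
  (nu x - nu y) * (lc (x + y) * (z + root0 (x + y)))
  + (if x + y == 0 then (nu x ^+ 3 - nu x) / 12%:R else 0) * c`_0.
Proof.
have := congr1 (fun p => p.[z]) (a_bracket x y).
have ec : c.[z] = c`_0 by rewrite {1}c_const hornerC.
by rewrite !(hornerD, hornerN, hornerM, hornerZ) ec !horner_shift !a_eval.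
Qed.

Lemma lcD_neq x y : x != y -> lc (x + y) = lc x * lc y.
Proof.
move=> xy; have d0 : nu x - nu y != 0 by rewrite subr_eq0 (inj_eq nu_inj).
apply: (mulfI d0).
have := a_bracket_eval x y 0; have := a_bracket_eval x y 1.
move: (if _ then _ else _) => k e1 e0.
have -> : (nu x - nu y) * lc (x + y) =
  ((nu x - nu y) * (lc (x + y) * (1 + root0 (x + y))) + k * c`_0)
  - ((nu x - nu y) * (lc (x + y) * (0 + root0 (x + y))) + k * c`_0) by ring.
by rewrite -e1 -e0; ring.
Qed.

Lemma lc0 : lc 0 = 1.
Proof. by rewrite /lc a_zero lead_coefX. Qed.

Lemma lcV x : x != 0 -> lc x * lc (- x) = 1.
Proof.
move=> x0; rewrite -lcD_neq ?subrr ?lc0 //.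
by rewrite -(inj_eq nu_inj) raddfN eq_sym eqNr nu_eq0.
Qed.

(** Comparing leading terms gives this only for [x != y]; doubling is recovered
    from the pair [x], [- (x + x)]. *)
Lemma lcD x y : lc (x + y) = lc x * lc y.
Proof.
have [<-|] := eqVneq x y; last exact: lcD_neq.
have [->|x0] := eqVneq x 0; first by rewrite addr0 lc0 mulr1.
have xx0 : x + x != 0.
  by rewrite -nu_eq0 raddfD -mulr2n mulrn_eq0 nu_eq0 (negPf x0).
have e : lc (- x) = lc x * lc (- (x + x)).
  rewrite -lcD_neq; first by rewrite opprD addNKr.
  rewrite -subr_eq0 opprK -nu_eq0 !raddfD -!mulr2n -mulrS mulrn_eq0 nu_eq0.
  by rewrite (negPf x0).
rewrite -[LHS]mul1r -(lcV x0) e.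
by rewrite -[RHS]mulr1 -(lcV xx0); ring.
Qed.

Lemma root0D x y :
  lc x * lc y * ((nu x - nu y) * root0 (x + y)
    - (nu x * root0 x - nu y * root0 y)) =
  - ((if x + y == 0 then (nu x ^+ 3 - nu x) / 12%:R else 0) * c`_0).
Proof.
have := a_bracket_eval x y 0; rewrite lcD; move: (if _ then _ else _) => k e.
by apply: (eq_of_subr_eq (esym e)); ring.
Qed.

Lemma root0D_neq x y : x + y != 0 ->
  (nu x - nu y) * root0 (x + y) = nu x * root0 x - nu y * root0 y.
Proof.
move=> xy; have := root0D x y; rewrite (negPf xy) mul0r oppr0.
move/eqP; rewrite !mulf_eq0 (negPf (lc_neq0 x)) (negPf (lc_neq0 y)) /= subr_eq0.
by move/eqP.
Qed.

Lemma root0_0 : root0 0 = 0.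
Proof. by rewrite /root0 a_zero coefX mul0r. Qed.

Lemma root0_opp_one : root0 (- one) = - root0 one.
Proof.
have := root0D one (- one); rewrite subrr eqxx nu_one expr1n subrr !mul0r oppr0.
move/eqP; rewrite !mulf_eq0 (negPf (lc_neq0 _)) (negPf (lc_neq0 _)) /=.
rewrite raddfN nu_one root0_0 mulr0 add0r mul1r mulN1r opprK oppr_eq0 addrC addr_eq0.
by move/eqP.
Qed.

(** Raising the weight by one and lowering it again gives two relations between
    [root0 x] and [root0 (x + one)]; eliminating the latter leaves
    [2 * root0 x = 2 * nu x * root0 one]. *)
Lemma root0_linear x : root0 x = nu x * root0 one.
Proof.
have [->|x0] := eqVneq x 0; first by rewrite root0_0 raddf0 mul0r.
have [x1|x1] := eqVneq (x + one) 0.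
  have -> : x = - one by apply/eqP; rewrite -addr_eq0 x1.
  by rewrite root0_opp_one raddfN nu_one mulN1r.
have up := root0D_neq x1.
have down : (nu (x + one) - nu (- one)) * root0 (x + one - one) =
  nu (x + one) * root0 (x + one) - nu (- one) * root0 (- one).
  by apply: root0D_neq; rewrite addrK.
rewrite addrK root0_opp_one raddfD raddfN nu_one in up down.
have two0 : (2%:R : K) != 0 by rewrite pnatr_eq0.
apply: (mulfI two0).
move: up down; move: (root0 x) (root0 (x + one)) (root0 one) (nu x) => t s t1 m up down.
have e : (m - 1) * ((m + 1 - - 1) * t) + (m + 1) * ((m - 1) * s)
  = (m - 1) * ((m + 1) * s - -1 * - t1) + (m + 1) * (m * t - 1 * t1).
  by rewrite down up.
by apply: (eq_of_subr_eq (esym e)); ring.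
Qed.

(** The weights 2 and -2 are the first for which the cocycle is nonzero; the
    linear form of [root0] makes the rest of that relation cancel. *)
Lemma c_eq0 : c = 0.
Proof.
have := root0D (one + one) (- (one + one)).
rewrite subrr eqxx root0_0 (root0_linear (one + one)) (root0_linear (- _)).
rewrite !(raddfN nu) !(raddfD nu) nu_one; set k := root0 one.
have -> : (1 + 1 - - (1 + 1)) * 0 - ((1 + 1) * ((1 + 1) * k)
    - - (1 + 1) * (- (1 + 1) * k)) = 0 :> K by ring.
rewrite mulr0 => /eqP; rewrite eq_sym oppr_eq0 => /eqP e.
have c0 : c`_0 = 2%:R * (((1 + 1) ^+ 3 - (1 + 1)) / 12%:R * c`_0) by field.
by rewrite c_const c0 e mulr0.
Qed.

Lemma a_form x : a x = lc x *: ('X + (nu x * root0 one)%:P).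
Proof. by rewrite -root0_linear; apply: size2_poly; apply: size_a. Qed.

Lemma rank_one_virasoro :
  [/\ c = 0, forall x, lead_coef (a x) != 0,
      forall x y, lead_coef (a (x + y)) = lead_coef (a x) * lead_coef (a y) &
      exists alpha, forall x,
        a x = lead_coef (a x) *: ('X + (nu x * alpha)%:P)].
Proof.
split; [exact: c_eq0|exact: lc_neq0|exact: lcD|].
by exists (root0 one); apply: a_form.
Qed.
End RankOneVirasoro.

(** * Polynomials in an operator *)

Section PolyAct.
Variables (K : numFieldType) (V : lmodType K) (T : {linear V -> V}).
Implicit Types (p q : {poly K}) (v w : V).

Lemma poly_act_widen (n : nat) p v :
  (size p <= n)%N -> poly_act T p v = \sum_(i < n) p`_i *: iter i T v.
Proof.
move=> pn; rewrite /poly_act (big_ord_widen _ (fun i => p`_i *: iter i T v) pn).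
rewrite big_mkcond; apply: eq_bigr => i _; case: ltnP => // ni.
by rewrite nth_default // scale0r.
Qed.

Lemma poly_act_linear v : linear (fun p => poly_act T p v).
Proof.
move=> c p q; pose n := maxn (size p) (size q).
have sp : (size p <= n)%N by apply: leq_maxl.
have sq : (size q <= n)%N by apply: leq_maxr.
have sc : (size (c *: p + q)%R <= n)%N.
  by apply: (leq_trans (size_polyD _ _)); rewrite geq_max sq (leq_trans (size_scale_leq _ _)).
rewrite !(@poly_act_widen n) // scaler_sumr -big_split; apply: eq_bigr => i _ /=.
by rewrite coefD coefZ scalerDl scalerA.
Qed.

Lemma poly_actD p q v : poly_act T (p + q) v = poly_act T p v + poly_act T q v.
Proof. by have := poly_act_linear v 1 p q; rewrite !scale1r. Qed.

Lemma poly_actC c v : poly_act T c%:P v = c *: v.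
Proof.
by rewrite (@poly_act_widen 1) ?size_polyC_leq1 // big_ord1 coefC.
Qed.

Lemma poly_act0 v : poly_act T 0 v = 0.
Proof. by rewrite -polyC0 poly_actC scale0r. Qed.

Lemma poly_act1 v : poly_act T 1 v = v.
Proof. by rewrite -polyC1 poly_actC scale1r. Qed.

Lemma poly_actZ c p v : poly_act T (c *: p) v = c *: poly_act T p v.
Proof. by have := poly_act_linear v c p 0; rewrite !addr0 poly_act0 addr0. Qed.

Lemma poly_actMX p v : poly_act T (p * 'X) v = T (poly_act T p v).
Proof.
rewrite (@poly_act_widen (size p).+1); last first.
  by apply: leq_trans (size_polyMleq _ _) _; rewrite size_polyX addn2.
rewrite big_ord_recl coefMX scale0r add0r /poly_act linear_sum.
by apply: eq_bigr => i _; rewrite coefMX linearZ.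
Qed.

Lemma poly_actX v : poly_act T 'X v = T v.
Proof. by rewrite -['X]mul1r poly_actMX poly_act1. Qed.

Lemma poly_actM p q v : poly_act T (p * q) v = poly_act T p (poly_act T q v).
Proof.
elim/poly_ind: p => [|p c IH]; first by rewrite mul0r !poly_act0.
rewrite mulrDl !poly_actD -mulrA (mulrC 'X) mulrA !poly_actMX IH.
by rewrite mul_polyC poly_actZ poly_actC.
Qed.

Lemma poly_act_shift (D : {linear V -> V}) m p v :
  (forall w, D (T w) = T (D w) + m *: D w) ->
  D (poly_act T p v) = poly_act T (shift m p) (D v).
Proof.
move=> DT; elim/poly_ind: p => [|p c IH].
  by rewrite /shift comp_poly0 !poly_act0 linear0.
rewrite poly_actD poly_actMX linearD DT IH poly_actC linearZ.
rewrite /shift comp_polyD comp_polyM comp_polyX comp_polyC mulrDr.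
by rewrite !poly_actD poly_actMX poly_actC [_ * m%:P]mulrC mul_polyC poly_actZ.
Qed.

Lemma poly_act_stable (U : submodClosed V) p v :
  (forall w, w \in U -> T w \in U) -> v \in U -> poly_act T p v \in U.
Proof.
move=> TU vU; apply: rpred_sum => i _; apply: rpredZ.
by elim: (nat_of_ord i) => //= n; apply: TU.
Qed.
End PolyAct.

(** * Coefficients of a free module of rank (1|1) *)

Section Frame.
Variables (K : numFieldType) (Gamma : zmodClosed (K * 'Z_2)%type).
Local Notation GT := (subgroup_of Gamma).
Local Notation L0 := (sV_L0 Gamma).

(** The basis vector seen in the superalgebra rather than in the underlying
    space of finitely supported functions, so that [act] and [part] apply. *)
Definition bv (k : option GT) : super_virasoro Gamma := bvec K k.
Definition weight (k : option GT) : K := if k is Some x then val0 x else 0.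

Lemma bv_part k : bv k \in part (super_virasoro Gamma) (bpar k).
Proof. exact: sV_partU. Qed.

Lemma L0E : L0 = bv (Some 0).
Proof. by congr (bvec K (Some _)); apply: val_inj. Qed.

Record frame (M : smodule (super_virasoro Gamma)) := Frame {
  gen : 'Z_2 -> M;
  gen_part : forall i, gen i \in part M i;
  gen_span : forall i v, v \in part M i ->
    exists p, v = poly_act (act M L0) p (gen i);
  gen_free : forall i p q,
    poly_act (act M L0) p (gen i) = poly_act (act M L0) q (gen i) -> p = q }.

Lemma frame_of_free (M : smodule (super_virasoro Gamma)) :
  free_of_rank (act M L0) (part M 0) 1 ->
  free_of_rank (act M L0) (part M 1) 1 -> inhabited (frame M).
Proof.
move=> [e0 [pe0 he0]] [e1 [pe1 he1]].
pose e (i : 'Z_2) := if i == 0 then e0 ord0 else e1 ord0.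
have sum1 (c : {ffun 'I_1 -> {poly K}}) (e' : 'I_1 -> M) :
    \sum_(i < 1) poly_act (act M L0) (c i) (e' i) =
    poly_act (act M L0) (c ord0) (e' ord0) by rewrite big_ord1.
have he i v : v \in part M i ->
    exists! p, v = poly_act (act M L0) p (e i).
  move=> vi; have [c [hc uc]] : exists! c : {ffun 'I_1 -> {poly K}},
      v = poly_act (act M L0) (c ord0) (e i).
    have [ei|ei] := Z2_cases i; rewrite /e ei /=; rewrite ei in vi.
      by have [c [hc uc]] := he0 v vi; exists c; split;
        [rewrite -sum1|move=> c' hc'; apply: uc; rewrite sum1].
    by have [c [hc uc]] := he1 v vi; exists c; split;
      [rewrite -sum1|move=> c' hc'; apply: uc; rewrite sum1].
  exists (c ord0); split=> // p hp.
  by rewrite (uc [ffun=> p]) ffunE.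
have pe i : e i \in part M i.
  by have [->|->] := Z2_cases i; [apply: pe0|apply: pe1].
split; apply: (@Frame M e) => // [i v /he [p [hp _]]|i p q pq]; first by exists p.
have [|r [_ ur]] := he i (poly_act (act M L0) p (e i)).
  apply: poly_act_stable => // w wi.
  by rewrite -(add0r i); apply: act_part wi; apply: (@bv_part (Some _)).
by rewrite -(ur p) // -(ur q).
Qed.

Variables (M : smodule (super_virasoro Gamma)) (F : frame M).
Local Notation e := (gen F).
Local Notation T := (act M L0).

Lemma coef_ex k i : exists p : {poly K},
  act M (bv k) (e i) == poly_act T p (e (bpar k + i)).
Proof.
have [|p ->] := gen_span F (i := bpar k + i) (v := act M (bv k) (e i)).
  by apply: act_part (gen_part F i); apply: bv_part.
by exists p.
Qed.

Definition coef k i : {poly K} := xchoose (coef_ex k i).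

Lemma coefP k i : act M (bv k) (e i) = poly_act T (coef k i) (e (bpar k + i)).
Proof. by apply/eqP/(xchooseP (coef_ex k i)). Qed.

(** Basis vectors are eigenvectors of [ad L_0], so on [M] they commute with
    [L_0] up to a translation by their weight. *)
Lemma act_L0_comm k v :
  act M (bv k) (T v) = T (act M (bv k) v) + weight k *: act M (bv k) v.
Proof.
have := act_br v (bv_part (Some 0)) (bv_part k).
rewrite -L0E /koszul mul0n expr0 scale1r.
have -> : lie_br (super_virasoro Gamma) L0 (bv k) = - weight k *: bv k.
  rewrite L0E /= sV_brU; case: k => [x|] /=; last by rewrite oppr0 scale0r.
  rewrite add0r /sV_cocycle add0r /sV_coef; have -> : val0 (0 : GT) = 0 by [].
  rewrite par0 eqxx expr0n mul0r !sub0r oppr0 mul0r.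
  by rewrite !if_same scale0r addr0.
rewrite linearZl_LR /= => e0.
by rewrite -[LHS](subKr (T (act M (bv k) v))) -e0 scaleNr opprK.
Qed.

Lemma act_gen k p i :
  act M (bv k) (poly_act T p (e i)) =
  poly_act T (shift (weight k) p * coef k i) (e (bpar k + i)).
Proof.
by rewrite (poly_act_shift _ _ (act_L0_comm k)) /= coefP poly_actM.
Qed.

(** The brackets of the [L_m] and [G_r] as identities between polynomials: both
    sides are multiples of the same generator, which is free. *)
Lemma coef_bracket x y i :
  shift (val0 x) (coef (Some y) i) * coef (Some x) (par y + i)
  - koszul K (par x) (par y) *:
      (shift (val0 y) (coef (Some x) i) * coef (Some y) (par x + i)) =
  sV_coef x y *: coef (Some (x + y)) i + sV_cocycle x y *: coef None i.
Proof.
apply: (gen_free (f := F) (i := par x + (par y + i))).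
have := act_br (e i) (bv_part (Some x)) (bv_part (Some y)).
rewrite !coefP !act_gen /= => h; rewrite !poly_actD.
rewrite poly_actZ poly_actZ; rewrite -scaleNr poly_actZ scaleNr.
rewrite [in X in _ - X]addrCA -h sV_brU /=.
rewrite linearDl /= !linearZl_LR /= -/(bv (Some (x + y))) -/(bv None) !coefP /=.
rewrite parD addrA; congr (_ + _); rewrite add0r.
rewrite /sV_cocycle; case: (x + y =P 0) => [xy|_] /=; last by rewrite !scale0r.
by rewrite -parD xy par0 add0r.
Qed.

Lemma coef_central k i :
  coef k i * coef None (bpar k + i) = shift (weight k) (coef None i) * coef k i.
Proof.
apply: (gen_free (f := F) (i := bpar k + i)).
have := act_br (e i) (bv_part None) (bv_part k).
rewrite !coefP !act_gen /= shift0 !add0r /koszul mul0n expr0 scale1r.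
by rewrite sV_brU linear0l => /esym/eqP; rewrite subr_eq0 => /eqP.
Qed.

Lemma coef_zero i : coef (Some 0) i = 'X.
Proof.
apply: (gen_free (f := F) (i := i)).
by have := coefP (Some 0) i; rewrite -L0E /= par0 add0r poly_actX.
Qed.
End Frame.

(** * Coefficients of the even basis vectors *)

(** The even elements form the index group of a Virasoro algebra, to which
    [rank_one_virasoro] applies. *)
Section EvenElements.
Variables (K : numFieldType) (Gamma : zmodClosed (K * 'Z_2)%type).
Local Notation GT := (subgroup_of Gamma).

Definition even_elt : {pred GT} := [pred x | par x == 0].

Lemma even_elt_closed : zmod_closed even_elt.
Proof.
split=> [|x y]; rewrite !inE ?par0 // => /eqP x0 /eqP y0.
by rewrite parD parN x0 y0 addr0.
Qed.
HB.instance Definition _ := GRing.isZmodClosed.Build GT even_elt even_elt_closed.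

Definition even_weight (x : subgroup_of even_elt) : K := val0 (\val x).

Lemma even_weight_additive : zmod_morphism even_weight.
Proof. by []. Qed.
HB.instance Definition _ :=
  GRing.isZmodMorphism.Build (subgroup_of even_elt) K even_weight
    even_weight_additive.

Lemma even_weight_inj : injective even_weight.
Proof.
move=> [x hx] [y hy]; rewrite /even_weight /= => xy.
apply: val_inj => /=; apply: val_inj; move: hx hy xy; rewrite !inE /par /val0.
by case: (\val x) (\val y) => [m i] [n j] /= /eqP -> /eqP -> ->.
Qed.
End EvenElements.

Section Coefficients.
Variables (K : numFieldType) (Gamma : zmodClosed (K * 'Z_2)%type).
Local Notation GT := (subgroup_of Gamma).
Hypothesis one_in : (1, 0) \in Gamma.
Variables (M : smodule (super_virasoro Gamma)) (F : frame M).

Lemma even_coef i :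
  [/\ coef F None i = 0,
      forall x, par x = 0 -> lead_coef (coef F (Some x) i) != 0,
      forall x y, par x = 0 -> par y = 0 ->
        lead_coef (coef F (Some (x + y)) i) =
        lead_coef (coef F (Some x) i) * lead_coef (coef F (Some y) i) &
      exists alpha, forall x, par x = 0 ->
        coef F (Some x) i =
        lead_coef (coef F (Some x) i) *: ('X + (val0 x * alpha)%:P)].
Proof.
pose a (x : subgroup_of (@even_elt K Gamma)) := coef F (Some (\val x)) i.
have par_val (x : subgroup_of (@even_elt K Gamma)) : par (\val x) = 0.
  by case: x => x hx; apply/eqP.
have one_even : (SubgroupElt one_in : GT) \in @even_elt K Gamma by [].
have [||x y|x|c0 l0 lM [alpha ha]] :=
  @rank_one_virasoro K _ (@even_weight K Gamma) (SubgroupElt one_even) a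
    (coef F None i) (@even_weight_inj K Gamma).
- by [].
- exact: coef_zero.
- have := coef_bracket F (\val x) (\val y) i.
  rewrite !par_val !add0r /koszul mul0n expr0 scale1r /sV_coef /sV_cocycle.
  by rewrite !par_val !eqxx if_neg.
- by have := coef_central F (Some (\val x)) i; rewrite /= par_val add0r.
have lift (x : GT) : par x = 0 ->
    exists y : subgroup_of (@even_elt K Gamma), x = \val y.
  by move=> /eqP hx; exists (SubgroupElt (hx : x \in @even_elt K Gamma)).
split=> // [x /lift [y ->]|x y /lift [x' ->] /lift [y' ->]|].
- exact: l0.
- have -> : \val x' + \val y' = \val (x' + y') by [].
  exact: lM.
by exists alpha => x /lift [y ->]; apply: ha.
Qed.

Local Notation A x i := (coef F (Some x%R) i%R).
Local Notation f x := (lead_coef (coef F (Some x) 0)).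

(** * Coefficients of the odd basis vectors *)

(** For odd [s], [G_s] squares to [L_2s]. There is no central term left, as
    [C] already acts by zero. *)
Lemma coef_odd_square i s : par s = 1 ->
  shift (val0 s) (A s i) * A s (1 + i) = A (s + s) i.
Proof.
move=> s1; have := coef_bracket F s s i.
have [-> _ _ _] := even_coef i; rewrite scaler0 addr0 /sV_coef /koszul s1 /=.
rewrite expr1 scaleN1r opprK -mulr2n -scaler_nat => /scalerI; apply.
by rewrite pnatr_eq0.
Qed.

Lemma coef_even_odd i x s : par x = 0 -> par s = 1 ->
  shift (val0 x) (A s i) * A x (1 + i) - shift (val0 s) (A x i) * A s i =
  (val0 x / 2%:R - val0 s) *: A (x + s) i.
Proof.
move=> x0 s1; have := coef_bracket F x s i.
have [-> _ _ _] := even_coef i; rewrite scaler0 addr0 /sV_coef /koszul s1 x0 /=.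
by rewrite mul0n expr0 scale1r add0r.
Qed.

Lemma size_even_coef i x : par x = 0 -> size (A x i) = 2%N.
Proof.
move=> x0; have [_ l0 _ [alpha ->]] := even_coef i => //.
by rewrite size_scale ?l0 // size_XaddC.
Qed.

(** The product of the two coefficients of [G_s] is, up to a shift, the degree
    one polynomial of [L_2s]. *)
Lemma size_odd_coef s : par s = 1 ->
  size (A s 0) = 1%N /\ size (A s 1) = 2%N \/
  size (A s 0) = 2%N /\ size (A s 1) = 1%N.
Proof.
move=> s1; have := size_even_coef 0 (x := s + s).
rewrite parD s1 Z2_11 => /(_ erefl); rewrite -coef_odd_square // addr0 => sz.
have [|] := eqVneq (shift (val0 s) (A s 0) * A s 1) 0.
  by move=> e; rewrite e size_poly0 in sz.
rewrite mulf_eq0 negb_or => /andP [n1 n2].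
move: sz; rewrite size_mul // size_shift; move: n1 n2.
rewrite -!size_poly_gt0 size_shift.
case: (size (A s 0)) => [|[|[|n]]] //; case: (size (A s 1)) => [|[|[|k]]] //; auto.
all: by rewrite !(addSn, addnS).
Qed.

Lemma second_difference (p : {poly K}) : (size p <= 2)%N ->
  p.[2%:R] - 2%:R * p.[1] + p.[0] = 0.
Proof.
move=> sp; rewrite !(horner_coef_wide _ sp) !big_ord_recr !big_ord0 /=.
by rewrite !expr0 !expr1; ring.
Qed.

(** From here on [alpha] and [beta] are the parameters of the even and of the
    odd half, viewed as modules over the even subalgebra. The lemmas concern the
    odd [s] for which [G_s] maps the even generator to a scalar multiple of the
    odd one. *)
Section ConstantOddCoefficient.
Variables (alpha beta : K).
Hypothesis A0 : forall x, par x = 0 -> A x 0 = f x *: ('X + (val0 x * alpha)%:P).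
Hypothesis A1 : forall x, par x = 0 ->
  A x 1 = lead_coef (A x 1) *: ('X + (val0 x * beta)%:P).

(** Applied to the odd generator, [L_x G_s] and [G_s L_x] are quadratic with
    leading coefficients in the ratio of the two characters, while their
    commutator is a multiple of [G_(x+s)], of degree at most one. Second
    differences extract the quadratic term. *)
Lemma lead_even_coef_eq s x : par s = 1 -> size (A s 0) = 1%N -> par x = 0 ->
  lead_coef (A x 1) = f x.
Proof.
move=> s1 u1 x0; have [[_ v2]|[]] := size_odd_coef s1; last by rewrite u1.
have sz : (size (A (x + s) 1) <= 2)%N.
  have xs1 : par (x + s) = 1 by rewrite parD x0 s1 add0r.
  by have [[_ ->]|[_ ->]] := size_odd_coef xs1.
have := coef_even_odd 1 x0 s1; rewrite Z2_11.
have l0 : lead_coef (A s 1) != 0 by rewrite lead_coef_eq0 -size_poly_eq0 v2.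
move: (size2_poly v2) (A0 x0) (A1 x0) l0 (second_difference sz).
move: (lead_coef (A s 1)) (_ / _) (f x) (lead_coef (A x 1)) => nu t fx gx.
move: (A (x + s) 1) (val0 x / 2%:R - _) => p k -> -> -> nu0 sd e.
have {}e z := congr1 (fun p => p.[z]) e.
have two_nu : 2%:R * nu != 0 by rewrite mulf_neq0 // pnatr_eq0.
apply: (mulfI two_nu); apply: (@eq_of_subr_eq _ 0 (k * (p.[2%:R] - 2%:R * p.[1] + p.[0]))).
  by rewrite sd mulr0.
rewrite mulrDr mulrBr mulrCA.
move: (e 2%:R) (e 1) (e 0).
rewrite !hornerZ => <- <- <-.
rewrite !(hornerD, hornerN, hornerM, hornerZ, horner_shift, hornerX, hornerC).
ring.
Qed.

Lemma odd_const_coefE s : size (A s 0) = 1%N ->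
  exists2 mu, mu != 0 & A s 0 = mu%:P.
Proof.
move=> u1; have e := size1_polyC (eq_leq u1); exists (A s 0)`_0 => //.
by apply/eqP => e0; move: u1; rewrite e e0 size_poly0.
Qed.

(** The square of [G_s] on the two generators gives the same linear polynomial,
    once translated by [val0 s]; comparing its roots gives
    [val0 s * (beta - alpha - 1/2) = 0]. *)
Lemma exponent_odd_shift s : par s = 1 -> size (A s 0) = 1%N -> val0 s != 0 ->
  beta = alpha + 1 / 2%:R.
Proof.
move=> s1 u1 s0.
have ss0 : par (s + s) = 0 by rewrite parD s1 Z2_11.
have e0 := coef_odd_square 0 s1; have e1 := coef_odd_square 1 s1.
rewrite addr0 (A0 ss0) in e0; rewrite Z2_11 (A1 ss0) (lead_even_coef_eq s1 u1 ss0) in e1.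
have [_ l0 _ _] := even_coef 0; have := l0 _ ss0.
have [mu mu0 eu] := odd_const_coefE u1; rewrite eu shiftC in e0 e1.
move: e0 e1; rewrite val0D; move: (f (s + s)) (A s 1) (val0 s) s0 => fs v r r0 e0 e1 fs0.
have e0z := congr1 (fun p => p.[r]) e0.
have e1z := congr1 (fun p => p.[0]) e1.
have {e0z e1z} : fs * (r + (r + r) * alpha) = fs * (0 + (r + r) * beta).
  move: e0z e1z.
  rewrite !(hornerD, hornerN, hornerM, hornerZ, horner_shift, hornerX, hornerC).
  by rewrite !add0r => <- <-; rewrite mulrC.
move/(mulfI fs0) => e.
have r20 : 2%:R * r != 0 by rewrite mulf_neq0 // pnatr_eq0.
apply: (mulfI r20); apply: (eq_of_subr_eq (esym e)); by field.
Qed.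

Lemma odd_const_step s x : par s = 1 -> size (A s 0) = 1%N -> par x = 0 ->
  (val0 x / 2%:R - val0 s) *: A (x + s) 0 =
  (f x * (val0 x * (beta - alpha) - val0 s)) *: A s 0.
Proof.
move=> s1 u1 x0; rewrite -coef_even_odd // addr0.
move: (A0 x0) (A1 x0); rewrite (lead_even_coef_eq s1 u1 x0).
move: (f x) => fx -> ->; have [mu mu0 ->] := odd_const_coefE u1; rewrite shiftC /shift.
rewrite comp_polyZ comp_polyD comp_polyX comp_polyC -!mul_polyC.
by rewrite !(polyCM, polyCB, polyCD); ring.
Qed.

Lemma size_odd_const s mu : par s = 1 -> A s 0 = mu%:P -> size (A s 0) = 1%N.
Proof.
move=> s1 e; have [[]|[u2 _]] // := size_odd_coef s1.
by have := size_polyC_leq1 mu; rewrite -e u2.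
Qed.

Let one : GT := SubgroupElt one_in.

(** When [s] has weight zero, [one + s] has weight one and is again of constant
    type. *)
Lemma exponent_shift s : par s = 1 -> size (A s 0) = 1%N ->
  beta = alpha + 1 / 2%:R.
Proof.
move=> s1 u1; have [s0|] := eqVneq (val0 s) 0; last exact: exponent_odd_shift.
have os1 : par (one + s) = 1 by rewrite parD s1; apply: val_inj.
have := odd_const_step s1 u1 (erefl : par one = 0).
have -> : val0 one = 1 by [].
have [mu mu0 ->] := odd_const_coefE u1; rewrite s0 subr0 => e.
have h2 : (1 / 2%:R : K) != 0 by rewrite mul1r invr_eq0 pnatr_eq0.
apply: (@exponent_odd_shift (one + s)) => //; last by rewrite val0D s0 addr0 oner_neq0.
apply: (size_odd_const os1).
rewrite -[LHS](scalerK h2) e -!mul_polyC -!polyCM; reflexivity.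
Qed.

(** The bracket of [L_x] and [G_s] determines [G_(x+s)] unless its coefficient
    [val0 x / 2 - val0 s] vanishes. In that case the translation is done in two
    steps, [k] then [x - k], with [k] of weight 1 or -1 chosen so that neither
    step is degenerate. *)
Lemma odd_coef_translate s x : par s = 1 -> size (A s 0) = 1%N -> par x = 0 ->
  A (x + s) 0 = f x *: A s 0.
Proof.
have generic t y : par t = 1 -> size (A t 0) = 1%N -> par y = 0 ->
    val0 y != 2%:R * val0 t -> A (y + t) 0 = f y *: A t 0.
  move=> t1 u1 y0 ne.
  have d0 : val0 y / 2%:R - val0 t != 0.
    apply: contra_neq ne => e.
    have -> : val0 y = 2%:R * (val0 y / 2%:R - val0 t) + 2%:R * val0 t by field.
    by rewrite e mulr0 add0r.
  apply: (scalerI d0); rewrite odd_const_step // (exponent_shift t1 u1) scalerA.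
  by congr (_ *: _); field.
move=> s1 u1 x0.
have [xs|] := eqVneq (val0 x) (2%:R * val0 s); last exact: generic.
pose k := if val0 x == 1 then - one else one.
have k0 : par k = 0 by rewrite /k; case: ifP => _; rewrite ?parN.
have kx : val0 k != val0 x.
  rewrite /k; case: ifP => [/eqP ->|]; last by rewrite eq_sym => ->.
  by rewrite val0N eqNr oner_neq0.
have kn0 : val0 k != 0.
  by rewrite /k; case: ifP => _; rewrite ?val0N ?oppr_eq0 oner_neq0.
have [_ l0 lM _] := even_coef 0.
have e1 : A (k + s) 0 = f k *: A s 0 by apply: generic => //; rewrite -xs.
have -> : x + s = (x - k) + (k + s) by rewrite addrA subrK.
have xk0 : par (x - k) = 0 by rewrite parD parN x0 k0 addr0.
rewrite generic ?e1 //.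
- by rewrite scalerA -lM // subrK.
- by rewrite parD k0 s1 add0r.
- by rewrite size_scale // l0.
rewrite !val0D val0N xs mulrDr -subr_eq0.
have -> : 2%:R * val0 s - val0 k - (2%:R * val0 k + 2%:R * val0 s)
  = - (3%:R * val0 k) by ring.
by rewrite oppr_eq0 mulf_neq0 // pnatr_eq0.
Qed.

Lemma odd_coef_dual s mu : par s = 1 -> A s 0 = mu%:P ->
  mu *: A s 1 = f (s + s) *: ('X + ((2%:R * val0 s) * alpha)%:P).
Proof.
move=> s1 e; have := coef_odd_square 0 s1.
rewrite e shiftC mul_polyC addr0 => ->.
by rewrite [LHS]A0 ?parD ?s1 ?Z2_11 // val0D -mulr2n mulr_natl.
Qed.
End ConstantOddCoefficient.
End Coefficients.

(** * Isomorphisms and the parity switch *)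

Section ModuleIso.
Variables (K : fieldType) (g : lieSuperalgebra K).
Implicit Types M N : smodule g.

Lemma part_eq0 (V : superspace K) (v w : V) :
  v \in part V 0 -> w \in part V 1 -> v + w = 0 -> v = 0.
Proof.
move=> v0 w1 /eqP; rewrite addr_eq0 => /eqP e.
by apply: part_cap => //; rewrite e -scaleN1r rpredZ.
Qed.

Lemma smodule_iso_of_inverse M N (psi : {linear N -> M}) :
  injective psi -> (forall v, exists w, psi w = v) ->
  (forall i w, w \in part N i -> psi w \in part M i) ->
  (forall x w, psi (act N x w) = act M x (psi w)) -> smodule_iso M N.
Proof.
move=> psi_inj psi_surj psi_part psi_act.
have surj v : exists w, psi w == v by have [w <-] := psi_surj v; exists w.
pose phi v := xchoose (surj v).
have phiK : cancel phi psi by move=> v; apply/eqP/(xchooseP (surj v)).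
have psiK : cancel psi phi by move=> w; apply: psi_inj; rewrite phiK.
pose phi_lin : {linear M -> N} :=
  HB.pack phi (GRing.isLinear.Build K M N *:%R phi (can2_linear psiK phiK)).
exists phi_lin; split=> [|i v vi|x v] /=.
- by exists psi.
- have [w0 [w1 [h0 h1 e]]] := part_sum (phi v).
  have ev : v = psi w0 + psi w1 by rewrite -linearD -e phiK.
  have p0 := psi_part _ _ h0; have p1 := psi_part _ _ h1.
  have [ei|ei] := Z2_cases i; rewrite ei in vi *.
    have z : psi w1 = 0.
      apply: part_cap => //; rewrite -[psi w1](addrK (psi w0)) [psi w1 + _]addrC -ev.
      by rewrite rpredD // -scaleN1r rpredZ.
    by have /eqP := z; rewrite -(linear0 psi) (inj_eq psi_inj) e => /eqP ->; rewrite addr0.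
  have z : psi w0 = 0.
    by apply: part_cap => //; rewrite -[psi w0](addrK (psi w1)) -ev rpredD // -scaleN1r rpredZ.
  by have /eqP := z; rewrite -(linear0 psi) (inj_eq psi_inj) e => /eqP ->; rewrite add0r.
- by apply: psi_inj; rewrite psi_act !phiK.
Qed.

Lemma smodule_iso_Pi M N : smodule_iso (Pi_module M) N ->
  smodule_iso M (Pi_module N).
Proof.
move=> [phi [bij hp ha]]; exists phi; split=> // i v vi.
apply: (hp (i + 1)); rewrite /= /Pi_part.
by have [ei|ei] := Z2_cases i; rewrite ei ?add0r ?Z2_11 ?add0r in vi *.
Qed.
End ModuleIso.

Section PiFrame.
Variables (K : numFieldType) (Gamma : zmodClosed (K * 'Z_2)%type).
Variables (M : smodule (super_virasoro Gamma)) (F : frame M).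

Definition Pi_frame : frame (Pi_module M) :=
  @Frame K Gamma (Pi_module M) (fun i => gen F (i + 1))
    (fun i => gen_part F (i + 1)) (fun i => @gen_span _ _ _ F (i + 1))
    (fun i => @gen_free _ _ _ F (i + 1)).

Lemma coef_Pi_frame k i : coef Pi_frame k i = coef F k (i + 1).
Proof.
apply: (gen_free (f := F) (i := bpar k + (i + 1))).
have := coefP Pi_frame k i; rewrite /= coefP => ->.
by rewrite addrA.
Qed.
End PiFrame.

(** * The isomorphism with the model module *)

Section OmegaIso.
Variables (K : numFieldType) (Gamma : zmodClosed (K * 'Z_2)%type).
Local Notation GT := (subgroup_of Gamma).
Variables (M : smodule (super_virasoro Gamma)) (F : frame M).
Local Notation T := (act M (sV_L0 Gamma)).
Local Notation PP := ({poly K} * {poly K})%type.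
(* The odd generator of the model is sent to lambda times gen F 1, where
   lambda absorbs the free choice of gen F 1. *)
Variables (chi : character K Gamma) (alpha lambda : K).
Hypothesis lambda0 : lambda != 0.
Hypothesis cC : forall i, coef F None i = 0.
Hypothesis cL0 : forall x, par x = 0 ->
  coef F (Some x) 0 = chi x *: ('X + (val0 x * alpha)%:P).
Hypothesis cL1 : forall x, par x = 0 ->
  coef F (Some x) 1 = chi x *: ('X + (val0 x * (alpha + 1 / 2%:R))%:P).
Hypothesis cG0 : forall s, par s = 1 ->
  coef F (Some s) 0 = (lambda * chi s)%:P.
Hypothesis cG1 : forall s, par s = 1 ->
  lambda *: coef F (Some s) 1 = chi s *: ('X + (2%:R * val0 s * alpha)%:P).

Definition omega_map (w : PP) : M :=
  poly_act T w.1 (gen F 0) + lambda *: poly_act T w.2 (gen F 1).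

Lemma omega_map_linear : linear omega_map.
Proof.
move=> c [p q] [p' q']; rewrite /omega_map /=.
rewrite !poly_act_linear !scalerDr !scalerA addrACA (mulrC lambda) //.
Qed.
HB.instance Definition _ :=
  GRing.isLinear.Build K PP M *:%R omega_map omega_map_linear.

Lemma poly_act_part p i : poly_act T p (gen F i) \in part M i.
Proof.
apply: poly_act_stable (gen_part F i) => w wi.
by rewrite -(add0r i); apply: act_part wi; apply: (@bv_part _ _ (Some _)).
Qed.

Lemma omega_map_inj : injective omega_map.
Proof.
move=> w w' e; apply/eqP; rewrite -subr_eq0; apply/eqP.
have : omega_map (w - w') = 0 by rewrite linearB /= e subrr.
case: (w - w') => p q; rewrite /omega_map /= => z.
have p0 : poly_act T p (gen F 0) = 0.
  apply: part_eq0 z; first exact: poly_act_part.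
  by apply: rpredZ; apply: poly_act_part.
rewrite p0 add0r in z.
have q0 : poly_act T q (gen F 1) = 0 by apply: (scalerI lambda0); rewrite scaler0.
have -> : p = 0 by apply: (gen_free (f := F) (i := 0)); rewrite p0 poly_act0.
by have -> : q = 0 by apply: (gen_free (f := F) (i := 1)); rewrite q0 poly_act0.
Qed.

Lemma omega_map_surj v : exists w, omega_map w = v.
Proof.
have [v0 [v1 [/(gen_span F) [p ->] /(gen_span F) [q ->] ->]]] := part_sum v.
exists (p, lambda^-1 *: q).
by rewrite /omega_map /= poly_actZ scalerA divff // scale1r.
Qed.

Lemma omega_map_part i w : w \in part (super_Omega chi alpha) i ->
  omega_map w \in part M i.
Proof.
case: w => p q; rewrite /= inE /omega_map.
have [->|->] := Z2_cases i; rewrite /= => /eqP /= ->; rewrite poly_act0.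
  by rewrite scaler0 addr0 poly_act_part.
by rewrite add0r rpredZ // poly_act_part.
Qed.

Lemma omega_map_basis k w :
  act M (bv k) (omega_map w) = omega_map (Omega_basis chi alpha k w).
Proof.
case: w => p q; rewrite /omega_map linearD linearZ /= !act_gen.
case: k => [x|]; last by rewrite !cC !mulr0 !poly_act0.
rewrite /=; have [x0|x1] := Z2_cases (par x).
  by rewrite x0 /= !add0r cL0 // cL1 // -!scalerAr ![shift _ _ * _]mulrC.
rewrite x1 /= addr0 Z2_11 addrC -poly_actZ.
rewrite scalerAr cG1 // cG0 //.
congr (_ + _); first by rewrite -scalerAr mulrC.
by rewrite mulrC mul_polyC -scalerA poly_actZ.
Qed.

Lemma omega_map_act a w :
  omega_map (act (super_Omega chi alpha) a w) = act M a (omega_map w).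
Proof.
rewrite -[act _ a w]/(Omega_act chi alpha a w) (bvecE a).
elim/big_rec: _ => [|k b _ IH]; first by rewrite oact0l !linear0l linear0.
rewrite oactPl linearD linearZ /= IH oactU -omega_map_basis.
by rewrite linearDl linearZl_LR.
Qed.

Lemma iso_super_Omega : smodule_iso M (super_Omega chi alpha).
Proof.
apply: (@smodule_iso_of_inverse _ _ M (super_Omega chi alpha) omega_map).
- exact: omega_map_inj.
- exact: omega_map_surj.
- exact: omega_map_part.
- exact: omega_map_act.
Qed.
End OmegaIso.

(** * The classification *)

Section Classification.
Variables (K : numFieldType) (Gamma : zmodClosed (K * 'Z_2)%type).
Local Notation GT := (subgroup_of Gamma).
Hypothesis sqrt_ex : forall z : K, exists y, y ^+ 2 = z.
Hypothesis one_in : (1, 0) \in Gamma.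

Lemma central_act_eq0 (M : smodule (super_virasoro Gamma)) (F : frame M) v :
  act M (sV_C Gamma) v = 0.
Proof.
have C0 i : coef F None i = 0 by have [-> _ _ _] := even_coef one_in F i.
have [v0 [v1 [/(gen_span F) [p ->] /(gen_span F) [q ->] ->]]] := part_sum v.
rewrite linearD /= -/(bv None) !act_gen !C0 !mulr0.
by rewrite !poly_act0 addr0.
Qed.

(** A character of the even elements extends to all of [Gamma]: its value at the
    odd element [r] must be a square root [rho] of [f (r + r)], and that choice
    determines the rest. *)
Lemma extend_character (f : GT -> K) (r : GT) :
  par r = 1 ->
  (forall x, par x = 0 -> f x != 0) ->
  (forall x y, par x = 0 -> par y = 0 -> f (x + y) = f x * f y) ->
  exists (chi : character K Gamma) (rho : K),
    [/\ rho != 0, forall x, par x = 0 -> chi x = f x &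
        forall s, par s = 1 -> chi s = f (s - r) * rho].
Proof.
move=> r1 f0 fM; have rr0 : par (r + r) = 0 by rewrite parD r1 Z2_11.
have [rho rhoE] := sqrt_ex (f (r + r)).
have rho0 : rho != 0.
  by apply: contra_neq (f0 _ rr0) => e; rewrite -rhoE e expr0n.
have sub_even s : par s = 1 -> par (s - r) = 0.
  by move=> s1; rewrite parD parN s1 r1 Z2_11.
pose chi x := if par x == 0 then f x else f (x - r) * rho.
have chi0 x : chi x != 0.
  rewrite /chi; have [x0|x1] := Z2_cases (par x); first by rewrite x0 eqxx f0.
  by rewrite x1 /= mulf_neq0 // f0 // sub_even.
have chiM x y : chi (x + y) = chi x * chi y.
  rewrite /chi parD; have [x0|x1] := Z2_cases (par x);
    have [y0|y1] := Z2_cases (par y).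
  - by rewrite x0 y0 addr0 eqxx fM.
  - by rewrite x0 y1 add0r /= -addrA (fM _ _ x0 (sub_even _ y1)) mulrA.
  - by rewrite x1 y0 addr0 /= addrAC (fM _ _ (sub_even _ x1) y0) mulrAC.
  rewrite x1 y1 Z2_11 /=.
  have -> : x + y = (x - r) + (y - r) + (r + r).
    by rewrite addrACA !subrK.
  have x0 := sub_even _ x1; have y0 := sub_even _ y1.
  have xy0 : par ((x - r) + (y - r)) = 0 by rewrite parD x0 y0 addr0.
  rewrite (fM _ _ xy0 rr0) (fM _ _ x0 y0).
  by rewrite -rhoE; ring.
exists (Character chi0 chiM), rho; split=> // [x x0|s s1] /=.
  by rewrite /chi x0 eqxx.
by rewrite /chi s1.
Qed.

(** The extended character is fixed only up to a sign on odd elements, through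
    [rho]; rescaling the odd generator by [mu / rho] turns the constant
    coefficients of [G_s] into its values. *)
Lemma iso_super_Omega_of_const (M : smodule (super_virasoro Gamma)) (F : frame M) r :
  par r = 1 -> size (coef F (Some r) 0) = 1%N ->
  exists (f : character K Gamma) (alpha : K), smodule_iso M (super_Omega f alpha).
Proof.
move=> r1 ur.
have [_ l0 lM [alpha ha]] := even_coef one_in F 0.
have [C1 _ _ [beta hb]] := even_coef one_in F 1.
have [chi [rho [rho0 chi_even chi_odd]]] := extend_character r1 l0 lM.
have [mu mu0 umu] := odd_const_coefE ur.
have lam0 : mu / rho != 0 by rewrite mulf_neq0 // invr_eq0.
have cG0 s : par s = 1 -> coef F (Some s) 0 = (mu / rho * chi s)%:P.
  move=> s1; have sr0 : par (s - r) = 0 by rewrite parD parN s1 r1 Z2_11.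
  rewrite -[in LHS](subrK r s) (odd_coef_translate one_in ha hb) //.
  rewrite umu chi_odd // -mul_polyC -polyCM; congr (_%:P).
  by field.
exists chi, alpha; apply: (iso_super_Omega (F := F) lam0) => //.
- by move=> i; have [-> _ _ _] := even_coef one_in F i.
- by move=> x x0; rewrite (chi_even _ x0); exact: ha.
- move=> x x0; rewrite (chi_even _ x0) -(exponent_shift one_in ha hb r1 ur).
  by rewrite -(lead_even_coef_eq one_in ha hb r1 ur x0); apply: hb.
move=> s s1; have ss0 : par (s + s) = 0 by rewrite parD s1 Z2_11.
have c0 : chi s != 0 by apply: chi_neq0.
apply: (scalerI c0); rewrite scalerA (mulrC (chi s)).
rewrite (odd_coef_dual one_in ha s1 (cG0 s s1)) scalerA.
by rewrite -chiD (chi_even _ ss0).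
Qed.

End Classification.

Theorem theorem4p2 (R : realType) (Gamma : zmodClosed (R[i] * 'Z_2)%type)
    (h1 : (1, 0) \in Gamma)
    (hodd : exists r : R[i], (r, 1) \in Gamma)
    (M : smodule (super_virasoro Gamma))
    (h0free : free_of_rank (act M (sV_L0 Gamma)) (part M 0) 1)
    (h1free : free_of_rank (act M (sV_L0 Gamma)) (part M 1) 1) :
  (forall v : M, act M (sV_C Gamma) v = 0) /\
  exists (f : character R[i] Gamma) (alpha : R[i]),
    smodule_iso M (super_Omega f alpha) \/
    smodule_iso M (Pi_module (super_Omega f alpha)).
Proof.
have [F] := frame_of_free h0free h1free.
have sqrt_ex (z : R[i]) : exists y, y ^+ 2 = z.
  by exists (sqrtc z); apply: sqr_sqrtc.
split; first exact: (central_act_eq0 h1 F).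
have [r hr] := hodd; pose s := SubgroupElt hr.
have s1 : par s = 1 by [].
have [[u1 _]|[_ v1]] := size_odd_coef h1 F s1.
  have [f [alpha iso]] := iso_super_Omega_of_const sqrt_ex h1 s1 u1.
  by exists f, alpha; left.
have u1 : size (coef (Pi_frame F) (Some s) 0) = 1%N by rewrite coef_Pi_frame add0r.
have [f [alpha iso]] := iso_super_Omega_of_const sqrt_ex h1 s1 u1.
by exists f, alpha; right; apply: smodule_iso_Pi.
Qed.
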